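(* Let $p>1$ be an integer, $\boldsymbol d=(d_0,\dots,d_{p-1})\in\{0,1\}^p$, $a\in\mathbb C$ and let $V$ be an irreducible $\mathbb T_{\min\{\boldsymbol d\}}$-module of some fixed annihilating level. Then for any $f\in\mathbb C[x^{\pm1}]$, the $\mathbb T$-module $M^f_{\mathbb T}(V,a,\boldsymbol d)$ is irreducible.
   Context: All vector spaces and algebras are over $\mathbb C$; $\mathbb N$ denotes the non-negative integers; the convention $0^0=1$ is used in the formulas. Twisted Heisenberg-Virasoro algebra $\mathbb T$: the Lie algebra with basis $\{L_n,I_n,C_L,C_{LI},C_I\mid n\in\mathbb Z\}$, with $C_L,C_{LI},C_I$ central and $[L_m,L_n]=(n-m)L_{m+n}+\frac1{12}(m^3-m)C_L\delta_{m+n,0}$, $[L_m,I_n]=nI_{m+n}+(m^2+m)C_{LI}\delta_{m+n,0}$, $[I_m,I_n]=mC_I\delta_{m+n,0}$. For $n\in\mathbb N$, $\mathbb T_n=\mathrm{Span}_{\mathbb C}\{L_k,I_{n+k}\mid k\in\mathbb N\}$, a subalgebra of $\mathbb T$. For $h,q\in\mathbb N$ with $h\ge n$, a $\mathbb T_n$-module $V$ has annihilating level $(h,q)$ if $I_hV\ne0$, $L_qV\ne0$ and $I_kV=L_lV=0$ for all $k>h$, $l>q$. $\min\{\boldsymbol d\}=\min\{d_0,\dots,d_{p-1}\}$. $M_{\mathbb T}(V,a,\boldsymbol d)$ denotes the $\mathbb T$-module $V\otimes\mathbb C[x^{\pm1}]$ with, writing $v(k)=v\otimes x^k$, $$L_m\cdot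 v(k)=\Big(a+k+\sum_{j=0}^\infty\frac{m^{j+1}}{(j+1)!}L_j\Big)v(m+k),\quad I_{pm+i}\cdot v(k)=\sum_{j=0}^\infty\frac{(pm+i)^{j+d_i}}{(j+d_i)!}I_{j+d_i}v(pm+i+k),$$ $$C_L\cdot v(k)=C_{LI}\cdot v(k)=C_I\cdot v(k)=0$$ for $m,k\in\mathbb Z$, $v\in V$, $0\le i\le p-1$. For $f=\sum_ia_ix^i\in\mathbb C[x^{\pm1}]$, $M^f_{\mathbb T}(V,a,\boldsymbol d)$ denotes the $\mathbb T$-module with the same underlying space as $M_{\mathbb T}(V,a,\boldsymbol d)$ and action $L_m\circ v=\big(L_m+\sum_ia_iI_{m+i}\big)\cdot v$, $I_m\circ v=I_m\cdot v$ for $m\in\mathbb Z$, $v\in M_{\mathbb T}(V,a,\boldsymbol d)$, with $C_L,C_{LI},C_I$ acting as $0$.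
   Formalization: M^f is not a T-module for every d (it fails for p=2, d=(0,1), V one-dimensional with I_0≠0); proved instead: M^f is nonzero with no proper nonzero subspace stable under T's action, and it is a T-module exactly when d is constant or I_0V=0. *)

(* Defs.v *)
From HB Require Import structures.
From mathcomp Require Export all_boot all_order all_algebra.
From mathcomp Require Export complex.
From mathcomp Require Export boolp classical_sets functions cardinality fsbigop.
From mathcomp Require Export reals.

Set Implicit Arguments.
Unset Strict Implicit.
Unset Printing Implicit Defensive.

Import Order.TTheory GRing.Theory Num.Theory.
Local Open Scope classical_set_scope.
Local Open Scope ring_scope.

(* The field C of complex numbers is R[i] for R : realType; the definitions
   below make sense over any field.

   V (x) C[x, x^-1] is realized as the space of finitely supported functions
   from int to V: w stands for the sum over k of (w k) (x) x^k. In particular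
   laurent C^o is C[x, x^-1] itself. *)
Section Laurent.
Variables (C : fieldType) (V : lmodType C).

Definition finitely_supported : {pred int -> V} :=
  fun w => `[< finite_set [set k | w k != 0] >].

Lemma finitely_supported_submod : submod_closed finitely_supported.
Proof.
split.
  apply/asboolP; apply: (sub_finite_set _ (@finite_set0 int)) => k /=.
  by rewrite eqxx.
move=> c u w /asboolP fu /asboolP fw; apply/asboolP.
apply: (sub_finite_set (B := [set k | u k != 0] `|` [set k | w k != 0])).
  2: by rewrite finite_setU.
move=> k /= nz.
case: (eqVneq (u k) 0) => [u0|]; last by left.
right; apply: contraNneq nz => w0.
by rewrite fctE /= [X in X + _](_ : _ = c *: u k) // u0 w0 scaler0 addr0.
Qed.

HB.instance Definition _ :=
  GRing.isSubmodClosed.Build C (int -> V) finitely_supported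
    finitely_supported_submod.

Record laurent := Laurent {
  lcoef :> int -> V;
  lcoef_finite : lcoef \in finitely_supported }.

HB.instance Definition _ := [isSub for lcoef].
HB.instance Definition _ := [Choice of laurent by <:].
HB.instance Definition _ := [SubChoice_isSubLmodule of laurent by <:].

(* v(k) = v (x) x^k *)
Lemma monom_finite (v : V) (k : int) :
  (fun t : int => if t == k then v else 0) \in finitely_supported.
Proof.
apply/asboolP; apply: (sub_finite_set _ (finite_set1 k)) => t /=.
by case: (eqVneq t k) => // _ /eqP.
Qed.

Definition monom (v : V) (k : int) : laurent := Laurent (monom_finite v k).

End Laurent.

Inductive T_basis := L of int | I of int | C_L | C_LI | C_I.

Section TwistedHeisenbergVirasoro.
Variable C : fieldType.

(* [x, y] for basis elements x and y, as a formal linear combination: the list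
   of (coefficient, basis element) pairs to be summed. *)
Definition bracket (x y : T_basis) : seq (C * T_basis) :=
  match x, y with
  | L m, L n => [:: ((n - m)%:~R, L (m + n));
                    ((m ^+ 3 - m)%:~R / 12 *+ (m + n == 0), C_L)]
  | L m, I n => [:: (n%:~R, I (m + n));
                    ((m ^+ 2 + m)%:~R *+ (m + n == 0), C_LI)]
  | I m, L n => [:: (- m%:~R, I (n + m));
                    (- ((n ^+ 2 + n)%:~R *+ (n + m == 0)), C_LI)]
  | I m, I n => [:: (m%:~R *+ (m + n == 0), C_I)]
  | _, _ => [::]
  end.

(* The basis of the subalgebra T_n. *)
Definition T_sub (n : nat) : set T_basis := fun x =>
  match x with
  | L k => 0 <= k
  | I k => n%:Z <= k
  | _ => false
  end.

(* Throughout, S is a set of basis elements spanning a subalgebra of T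
   (setT for T itself, T_sub n for T_n) and act gives the action of these
   elements on W; the values of act outside S are irrelevant. *)
Section Modules.
Variables (S : set T_basis) (W : lmodType C) (act : T_basis -> W -> W).

Definition is_module : Prop :=
  (forall x, S x ->
     forall (c : C) (u v : W), act x (c *: u + v) = c *: act x u + act x v) /\
  (forall x y, S x -> S y -> forall w : W,
     act x (act y w) - act y (act x w)
       = \sum_(cz <- bracket x y) cz.1 *: act cz.2 w).

Definition stable_subspace (U : set W) : Prop :=
  [/\ U 0,
      forall (c : C) (u v : W), U u -> U v -> U (c *: u + v)
    & forall x, S x -> forall u, U u -> U (act x u)].

(* Irreducibility does not include is_module: when d is not constant and I_0
   acts on V by a nonzero operator, the operators MTf below do not satisfy the
   relations of T (the relation for [L_m, I_n] fails when the residues of n and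
   m + n modulo p have different entries in d), but the absence of nontrivial
   stable subspaces still makes sense. *)
Definition irreducible : Prop :=
  (exists w : W, w <> 0) /\
  (forall U : set W, stable_subspace U -> U = [set 0] \/ U = setT).

End Modules.

Definition annihilating_level (n : nat) (V : lmodType C)
    (act : T_basis -> V -> V) (h q : nat) : Prop :=
  [/\ (n <= h)%N,
      exists v, act (I h%:Z) v <> 0,
      exists v, act (L q%:Z) v <> 0,
      forall k : nat, (h < k)%N -> forall v, act (I k%:Z) v = 0
    & forall l : nat, (q < l)%N -> forall v, act (L l%:Z) v = 0].

Section MT.
Variables (p : nat) (d : p.-tuple 'I_2).

(* The neutral element 1 is harmless, the entries being at most 1. *)
Definition min_d : nat := \big[minn/1%N]_(x <- d) (x : nat).

(* d_i, for the i in {0, ..., p-1} congruent to n modulo p *)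
Definition d_res (n : int) : nat := nth ord0 d `|(n %% p%:Z)%Z|%N.

Variables (a : C) (V : lmodType C) (act : T_basis -> V -> V).

(* The sums over j and k are finitely supported when act comes from a module
   having some annihilating level. *)
Definition MT (x : T_basis) (w : laurent V) : laurent V :=
  match x with
  | L m => \sum_(k \in [set: int])
      monom ((a + k%:~R) *: w k
             + \sum_(j \in [set: nat])
                 (m%:~R ^+ j.+1 / (j.+1)`!%:R) *: act (L j%:Z) (w k)) (m + k)
  | I n => \sum_(k \in [set: int])
      monom (\sum_(j \in [set: nat])
               (n%:~R ^+ (j + d_res n) / (j + d_res n)`!%:R)
                 *: act (I (j + d_res n)%N%:Z) (w k)) (n + k)
  | _ => 0
  end.

Definition MTf (f : laurent C^o) (x : T_basis) (w : laurent V) : laurent V :=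
  match x with
  | L m => MT (L m) w + \sum_(i \in [set: int]) (f i : C) *: MT (I (m + i)) w
  | I m => MT (I m) w
  | _ => 0
  end.

End MT.
End TwistedHeisenbergVirasoro.

Arguments MTf {C p} d a {V} act f x w.
Arguments irreducible {C} S {W} act.
Arguments is_module {C} S {W} act.

(* Main.v *)
Require Import Defs.
From HB Require Import structures.
From mathcomp Require Import finmap ring zify.

Set Implicit Arguments.
Unset Strict Implicit.
Unset Printing Implicit Defensive.

Import Order.TTheory GRing.Theory Num.Theory.
Local Open Scope classical_set_scope.
Local Open Scope ring_scope.

(* Work with finitely supported functions int -> V. As I_0 is central in T_0,
   one has [L_m, I_n] = n I_(m+n) up to the residue class governing the I_0-term:
   the right-hand side carries the class of n instead of that of m + n. This
   gives the criterion for M^f to be a module.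
   For irreducibility, let U be a nonzero stable subspace. It is stable under the
   I_n, hence under the untwisted L_m. Now L_0 v(k) = (a + k) v(k), so U is
   graded and contains some v(k) with v != 0. By the commutators above, U is
   stable under sum_j l^j/j! I_j followed by the shift by l, for every integer l,
   with I_0 included whenever min d = 0. Applying this with l - m and then m, the
   coefficient of m^(2h) is, up to a nonzero scalar, I_h^2 followed by the shift
   by l. Since I_h is injective on V (its kernel is a submodule), the space of all
   v with v(k) in U for every k is nonzero; taking the coefficients in m of
   I_m v(k - m) and L_m v(k - m) shows that it is a submodule of V. *)

(** * Divided powers x^n/n! and their binomial identities *)

Section DividedPowers.
Variable C : numFieldType.
Implicit Types x y : C.

Definition dpow x n : C := x ^+ n / n`!%:R.

Lemma fact_neq0 n : n`!%:R != 0 :> C.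
Proof. by rewrite pnatr_eq0 -lt0n fact_gt0. Qed.

Lemma dpow0 x : dpow x 0 = 1.
Proof. by rewrite /dpow expr0 fact0 divr1. Qed.

Lemma dpowS x n : n.+1%:R * dpow x n.+1 = x * dpow x n.
Proof.
have := fact_neq0 n; have : n.+1%:R != 0 :> C by rewrite pnatr_eq0.
by rewrite /dpow factS natrM exprS => nS nF; field; rewrite nF nat1r.
Qed.

Lemma dpow_horner x n : dpow x n = ((n`!%:R)^-1 *: 'X^n).[x].
Proof. by rewrite hornerZ hornerXn mulrC. Qed.

Lemma dpowD x y n : dpow (x + y) n = \sum_(j < n.+1) dpow x j * dpow y (n - j).
Proof.
rewrite /dpow addrC exprDn mulr_suml; apply: eq_bigr => -[j /=]; rewrite ltnS => jn _.
rewrite -mulr_natr -(bin_fact jn) !natrM.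
have := fact_neq0 j; have := fact_neq0 (n - j).
have : 'C(n, j)%:R != 0 :> C by rewrite pnatr_eq0 -lt0n bin_gt0.
by move=> ? ? ?; field; do ?[apply/andP; split].
Qed.

(** The binomial expansion in degree n + 1 without its term in x^0, since n - j = (n + 1) - (j +
    1). *)
Lemma sum_dpowSl x y n :
  \sum_(j < n.+1) dpow x j.+1 * dpow y (n - j) = dpow (x + y) n.+1 - dpow y n.+1.
Proof. by rewrite dpowD [in RHS]big_ord_recl dpow0 mul1r subn0 addrC addKr. Qed.

Lemma sum_dpowSr x y n :
  \sum_(j < n.+1) dpow x j * dpow y (n - j).+1 = dpow (x + y) n.+1 - dpow x n.+1.
Proof.
rewrite [x + y]addrC -sum_dpowSl (reindex_inj rev_ord_inj) /=.
apply: eq_bigr => -[j /=]; rewrite ltnS => jn _.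
by rewrite subSS subKn // mulrC.
Qed.

End DividedPowers.

(** * Products of truncated series *)

Section Convolution.
Variables (C : comPzRingType) (V : lmodType C).

(** The square of pairs (j, k) is regrouped along the antidiagonals j + k = r; those with r >= N
    leave the square but carry only zero terms. It serves to evaluate commutators of two series
    whose terms depend on j + k. *)
Lemma sum_convolution N (c : nat -> nat -> C) (X : nat -> V) :
    (forall r, (N <= r)%N -> X r = 0) ->
  \sum_(j < N) \sum_(k < N) c j k *: X (j + k)%N =
  \sum_(r < N) (\sum_(j < r.+1) c j (r - j)%N) *: X r.
Proof.
move=> X0.
transitivity (\sum_(j < N) \sum_(r < N | (j <= r)%N) c j (r - j)%N *: X r).
  apply: eq_bigr => j _.
  have jN : (j <= N)%N by exact: ltnW.
  rewrite -(@big_geq_mkord _ _ _ j N xpredT (fun r => c j (r - j)%N *: X r)).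
  rewrite -(big_mkord xpredT (fun k => c j k *: X (j + k)%N)).
  transitivity (\sum_(j <= r < N + j) c j (r - j)%N *: X r).
    have := @big_addn _ _ +%R 0 (N + j) j xpredT (fun r => c j (r - j)%N *: X r).
    rewrite add0n addnK => ->.
    by apply: eq_bigr => k _; rewrite addnK addnC.
  rewrite (@big_cat_nat _ _ _ N j (N + j) xpredT _ jN (leq_addr _ _)) /=.
  rewrite [X in _ + X = _]big_nat_cond [X in _ + X = _]big1 ?addr0 // => r.
  by rewrite andbT => /andP[Nr _]; rewrite X0 // scaler0.
rewrite (exchange_big_dep xpredT) //=; apply: eq_bigr => r _.
rewrite scaler_suml.
by rewrite (big_ord_widen _ (fun j => c j (r - j)%N *: X r) (ltn_ord r)).
Qed.

End Convolution.

(** * Extracting polynomial coefficients inside a subspace *)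

Section PolynomialCoefficients.
Variables (C : numFieldType) (W : lmodType C).

(* c is a column of the inverse of the Vandermonde matrix with nodes 0, ..., n - 1. *)
Lemma coef_functional n (i : 'I_n) :
  exists c : 'I_n -> C, forall q : {poly C}, (size q <= n)%N ->
    \sum_(m < n) c m * q.[(m : nat)%:R] = q`_i.
Proof.
pose nodes : 'rV[C]_n := \row_m (m : nat)%:R.
have uV : Vandermonde n nodes \in unitmx.
  rewrite unitmxE unitfE det_Vandermonde.
  apply/prodf_neq0 => j _; apply/prodf_neq0 => k jk.
  by rewrite !mxE subr_eq0 eqr_nat gtn_eqF.
have [c /matrixP Vc] : exists c : 'cV_n, Vandermonde n nodes *m c = delta_mx i 0.
  by exists (invmx (Vandermonde n nodes) *m delta_mx i 0); rewrite mulKVmx.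
have {}Vc k : \sum_m c m 0 * (m : nat)%:R ^+ (k : 'I_n) = (k == i)%:R.
  have := Vc k 0; rewrite !mxE eqxx andbT => <-.
  by apply: eq_bigr => m _; rewrite !mxE mulrC.
exists (fun m => c m 0) => q sq.
under eq_bigr do rewrite (horner_coef_wide _ sq) mulr_sumr.
rewrite exchange_big /=.
under eq_bigr => k _.
  under eq_bigr do rewrite mulrCA.
  rewrite -mulr_sumr Vc; over.
rewrite (bigD1 i) //= eqxx mulr1 big1 ?addr0 // => k /negbTE ->.
by rewrite mulr0.
Qed.

Variable U : set W.
Hypotheses (U0 : U 0) (UP : forall c u v, U u -> U v -> U (c *: u + v)).

Lemma setZ_closed c u : U u -> U (c *: u).
Proof. by move=> Uu; rewrite -[_ *: _]addr0; exact: UP. Qed.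

Lemma setD_closed u v : U u -> U v -> U (u + v).
Proof. by move=> Uu Uv; rewrite -[u]scale1r; exact: UP. Qed.

Lemma setB_closed u v : U u -> U v -> U (u - v).
Proof. by move=> Uu Uv; rewrite addrC -scaleN1r; exact: UP. Qed.

Lemma set_sum_closed (J : Type) (r : seq J) (P : pred J) (F : J -> W) :
  (forall j, P j -> U (F j)) -> U (\sum_(j <- r | P j) F j).
Proof. by move=> UF; elim/big_ind: _ => //; exact: setD_closed. Qed.

Lemma poly_extract (J : finType) (q : J -> {poly C}) (x : J -> W) :
    (forall m : nat, U (\sum_j (q j).[m%:R] *: x j)) ->
  forall i, U (\sum_j (q j)`_i *: x j).
Proof.
move=> Uq i.
(* [n] exceeds i and bounds all the sizes, so one functional on the values at 0, ..., n - 1 reads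
   off the coefficient of index i of every [q j] at once. *)
pose n := (i.+1 + \max_j size (q j))%N.
have sq j : (size (q j) <= n)%N.
  exact: leq_trans (leq_bigmax j) (leq_addl _ _).
have i_n : (i < n)%N by rewrite leq_addr.
have [c cP] := @coef_functional _ (Ordinal i_n).
rewrite (_ : \sum_j _ = \sum_(m < n) c m *: \sum_j (q j).[(m : nat)%:R] *: x j).
  by apply: set_sum_closed => m _; exact/setZ_closed/Uq.
under [RHS]eq_bigr do rewrite scaler_sumr.
rewrite exchange_big /=; apply: eq_bigr => j _.
rewrite -(cP _ (sq j)) scaler_suml.
by under [RHS]eq_bigr do rewrite scalerA.
Qed.

End PolynomialCoefficients.
Section DpowCoefficients.
Variables (C : numFieldType) (W : lmodType C) (U : set W).
Hypotheses (U0 : U 0) (UP : forall c u v, U u -> U v -> U (c *: u + v)).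

Lemma dpow_extract n (x : nat -> W) :
    (forall m : nat, U (\sum_(j < n) dpow m%:R j *: x j)) ->
  forall j, (j < n)%N -> U (x j).
Proof.
move=> Ux j jn.
have Up m : U (\sum_(k < n) ((k`!%:R)^-1 *: 'X^k : {poly C}).[m%:R] *: x k).
  by under eq_bigr do rewrite -dpow_horner; exact: Ux.
have := poly_extract U0 UP Up j.
rewrite (bigD1 (Ordinal jn)) //= [X in _ + X]big1 ?addr0 => [|k kj].
  rewrite coefZ coefXn eqxx mulr1 => /(setZ_closed U0 UP j`!%:R).
  by rewrite scalerA mulfV ?fact_neq0 // scale1r.
rewrite coefZ coefXn (_ : j == k = false) ?mulr0 ?scale0r //.
by apply: contraNF kj => /eqP jk; apply/eqP/val_inj.
Qed.

End DpowCoefficients.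

(** The polynomial has degree j + k, which reaches 2h only for j = k = h; its leading coefficient is
    then (-1)^h. *)
Lemma coef_subXM (C : idomainType) (c : C) (h j k : nat) :
    (j <= h)%N -> (k <= h)%N ->
  ((c%:P - 'X) ^+ j * 'X^k)`_(h + h) = (-1) ^+ h *+ ((j == h) && (k == h)).
Proof.
move=> jh kh; rewrite coefMXn ltnNge (leq_trans kh (leq_addr _ _)) /=.
have -> : (c%:P - 'X) ^+ j = (-1) ^+ j *: ('X - c%:P) ^+ j.
  by rewrite -opprB [LHS]exprNn -mul_polyC polyC_exp polyCN.
rewrite coefZ; have [/andP[/eqP -> /eqP ->]|] := boolP (_ && _).
  rewrite addnK -[X in _`_X]/(h.+1.-1) -(size_exp_XsubC h c) -lead_coefE.
  by rewrite (monicP (monic_exp _ (monicXsubC c))) mulr1.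
move=> jkh; rewrite nth_default ?mulr0 // size_exp_XsubC.
by move: jkh; rewrite negb_and => /orP[] /eqP; lia.
Qed.

(** * Generating series of the operators L_j and I_j on V *)

Section LevelModule.
Variables (C : numFieldType) (V : lmodType C) (N : nat).
Variables (lam iot : nat -> {linear V -> V}).
Hypotheses (lamN : forall j v, (N <= j)%N -> lam j v = 0)
  (iotN : forall j v, (N <= j)%N -> iot j v = 0)
  (lam_lam : forall j k v,
     lam j (lam k v) - lam k (lam j v) = (k%:R - j%:R) *: lam (j + k)%N v)
  (lam_iot : forall j k v,
     lam j (iot k v) - iot k (lam j v) = k%:R *: iot (j + k)%N v)
  (iot_iot : forall j k v, iot j (iot k v) = iot k (iot j v)).

Definition lam_series x v : V := \sum_(j < N) dpow x j.+1 *: lam j v.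
(** The I_0-term is always included here; the dependence on d enters only in [shifted_I]. *)
Definition iot_series x v : V := \sum_(j < N) dpow x j *: iot j v.

Lemma lam_series_linear x : linear (lam_series x).
Proof.
move=> c u v; rewrite /lam_series scaler_sumr -big_split /=.
by apply: eq_bigr => j _; rewrite linearP scalerDr !scalerA mulrC.
Qed.

Lemma iot_series_linear x : linear (iot_series x).
Proof.
move=> c u v; rewrite /iot_series scaler_sumr -big_split /=.
by apply: eq_bigr => j _; rewrite linearP scalerDr !scalerA mulrC.
Qed.

HB.instance Definition _ x :=
  GRing.isLinear.Build C V V *:%R (lam_series x) (lam_series_linear x).
HB.instance Definition _ x :=
  GRing.isLinear.Build C V V *:%R (iot_series x) (iot_series_linear x).

Lemma iot0_lam_series x v : iot 0%N (lam_series x v) = lam_series x (iot 0%N v).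
Proof.
rewrite /lam_series linear_sum; apply: eq_bigr => j _; rewrite linearZ /=.
by congr (_ *: _); apply/esym/eqP; rewrite -subr_eq0 lam_iot scale0r.
Qed.

Lemma iot_iot_series j x v : iot j (iot_series x v) = iot_series x (iot j v).
Proof.
rewrite /iot_series linear_sum; apply: eq_bigr => k _; rewrite linearZ /=.
by rewrite iot_iot.
Qed.

Lemma iot_series_comm x y v :
  iot_series x (iot_series y v) = iot_series y (iot_series x v).
Proof.
rewrite {1 4}/iot_series linear_sum; apply: eq_bigr => k _; rewrite linearZ /=.
by rewrite iot_iot_series.
Qed.

(** The coefficient of I_r is a sum over j + k = r with a factor k. As k y^k/k! = y y^(k-1)/(k-1)!,
    a factor y comes out and [sum_dpowSl] evaluates the rest. *)
Lemma lam_iot_series x y v :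
  lam_series x (iot_series y v) - iot_series y (lam_series x v) =
  y *: (iot_series (x + y) v - iot_series y v).
Proof.
pose c (j k : nat) := dpow x j.+1 * dpow y k * k%:R.
transitivity (\sum_(j < N) \sum_(k < N) c j k *: iot (j + k)%N v).
  rewrite [lam_series x v]/lam_series (linear_sum (iot_series y)) [lam_series x
    _]/lam_series -sumrB /=.
  apply: eq_bigr => j _; rewrite (linearZ_LR (iot_series y)) -scalerBr /=.
  rewrite [iot_series y v]/iot_series (linear_sum (lam j)) [iot_series y
    _]/iot_series -sumrB.
  rewrite scaler_sumr; apply: eq_bigr => k _.
  by rewrite linearZ -scalerBr /= lam_iot !scalerA.
rewrite (@sum_convolution _ _ N c (fun r => iot r v)) => [|r Nr]; last exact: iotN.
rewrite /iot_series -sumrB scaler_sumr; apply: eq_bigr => -[[|r] /= rN] _.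
  by rewrite big_ord1 /c subn0 mulr0 scale0r !dpow0 scale1r subrr scaler0.
rewrite -scalerBl scalerA -sum_dpowSl big_ord_recr /= /c subnn mulr0 addr0.
congr (_ *: _); rewrite mulr_sumr; apply: eq_bigr => -[j /= jr] _.
by rewrite subSn // [X in _ = X]mulrCA -dpowS; ring.
Qed.

(** The structure constant k - j is written as (k + 1) - (j + 1): [dpowS] turns each part into a
    factor y or x, leaving the two incomplete binomial sums. *)
Lemma lam_series_bracket x y v :
  lam_series x (lam_series y v) - lam_series y (lam_series x v) =
  (y - x) *: lam_series (x + y) v - y *: lam_series y v + x *: lam_series x v.
Proof.
pose c (j k : nat) := dpow x j.+1 * dpow y k.+1 * (k%:R - j%:R).
transitivity (\sum_(j < N) \sum_(k < N) c j k *: lam (j + k)%N v).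
  rewrite [lam_series x v]/lam_series (linear_sum (lam_series y)) [lam_series x
    _]/lam_series -sumrB /=.
  apply: eq_bigr => j _; rewrite (linearZ_LR (lam_series y)) -scalerBr /=.
  rewrite [lam_series y v]/lam_series (linear_sum (lam j)) [lam_series y
    _]/lam_series -sumrB.
  rewrite scaler_sumr; apply: eq_bigr => k _.
  by rewrite linearZ -scalerBr /= lam_lam !scalerA.
rewrite (@sum_convolution _ _ N c (fun r => lam r v)) => [|r Nr]; last exact: lamN.
rewrite /lam_series !scaler_sumr -sumrB -big_split /=.
apply: eq_bigr => -[r /= rN] _.
rewrite !scalerA -scalerBl -scalerDl; congr (_ *: _).
have -> : (y - x) * dpow (x + y) r.+1 - y * dpow y r.+1 + x * dpow x r.+1 =
  y * (dpow (x + y) r.+1 - dpow y r.+1) - x * (dpow (x + y) r.+1 - dpow x r.+1).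
  by ring.
rewrite -sum_dpowSl -sum_dpowSr !mulr_sumr -sumrB.
apply: eq_bigr => -[j /=]; rewrite ltnS => jr _.
rewrite [y * _]mulrCA [x * _]mulrA -!dpowS /c natrB // -![in RHS]natr1 natrB //.
by ring.
Qed.

(** * The operators of T on functions from [int] to V, and their commutators *)

Variables (a : C) (eps : int -> C) (fs : seq int) (fc : int -> C).
Implicit Types (w : int -> V) (l m n t : int).

(** The starting index d_n of the series for I_n becomes a correction term: the term of index 0 is
    I_0 for every n, as 0^0 = 1, so [eps n] equal to 1 deletes it and [eps n] equal to 0 keeps
    it. *)
Definition shifted_I n v : V := iot_series n%:~R v - eps n *: iot 0%N v.

Definition opI n w : int -> V := fun t => shifted_I n (w (t - n)).

Definition opL m w : int -> V :=
  fun t => (a + (t - m)%:~R) *: w (t - m) + lam_series m%:~R (w (t - m)).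

Definition opLf m w : int -> V := opL m w + \sum_(i <- fs) fc i *: opI (m + i) w.

Lemma shifted_I_linear n : linear (shifted_I n).
Proof.
by move=> c u v; rewrite /shifted_I !linearP addrACA -scalerDr.
Qed.

HB.instance Definition _ n :=
  GRing.isLinear.Build C V V *:%R (shifted_I n) (shifted_I_linear n).

Lemma opI_linear n : linear (opI n).
Proof. by move=> c u w; apply/funext => t; rewrite /opI !fctE linearP. Qed.

HB.instance Definition _ n :=
  GRing.isLinear.Build C (int -> V) (int -> V) *:%R (opI n) (opI_linear n).

Lemma opL_linear m : linear (opL m).
Proof.
move=> c u w; apply/funext => t; rewrite /opL !fctE ![in LHS]linearP.
by rewrite addrACA -scalerDr.
Qed.

HB.instance Definition _ m :=
  GRing.isLinear.Build C (int -> V) (int -> V) *:%R (opL m) (opL_linear m).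

Lemma opLf_linear m : linear (opLf m).
Proof.
move=> c u w; rewrite /opLf linearP scalerDr scaler_sumr addrACA -big_split /=.
by congr (_ + _); apply: eq_bigr => i _; rewrite linearP scalerDr !scalerA mulrC.
Qed.

Lemma shifted_I_comm m n v : shifted_I m (shifted_I n v) = shifted_I n (shifted_I m v).
Proof.
have expand p q : shifted_I p (shifted_I q v) =
    iot_series p%:~R (iot_series q%:~R v)
    - (eps q *: iot 0%N (iot_series p%:~R v) + eps p *: iot 0%N (iot_series q%:~R v))
    + (eps p * eps q) *: iot 0%N (iot 0%N v).
  rewrite [shifted_I q v]/shifted_I [shifted_I p _]/shifted_I.
  rewrite (linearB (iot_series p%:~R)) (linearZ_LR (iot_series p%:~R)) /=.
  rewrite -iot_iot_series (linearB (iot 0%N)) (linearZ_LR (iot 0%N)) /=.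
  by rewrite scalerBr scalerA opprB opprD !addrA addrAC.
rewrite !expand iot_series_comm [eps m * _]mulrC.
by rewrite [eps n *: _ + _]addrC.
Qed.

Lemma opI_comm m n w : opI m (opI n w) = opI n (opI m w).
Proof. by apply/funext => t; rewrite /opI shifted_I_comm addrAC. Qed.

Lemma lam_shifted_I x n v :
  lam_series x (shifted_I n v) - shifted_I n (lam_series x v) =
  n%:~R *: (iot_series (x + n%:~R) v - iot_series n%:~R v).
Proof.
rewrite /shifted_I (linearB (lam_series x)) (linearZ_LR (lam_series x)) /=.
by rewrite iot0_lam_series opprB subrKA lam_iot_series.
Qed.

(* The relation [L_m, I_n] = n I_(m+n) of T, except that the result inherits
   the residue class of n and not that of m + n. *)
Definition opI_at n l w : int -> V :=
  fun t => iot_series l%:~R (w (t - l)) - eps n *: iot 0%N (w (t - l)).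

Lemma opL_opI m n w :
  opL m (opI n w) - opI n (opL m w) = n%:~R *: opI_at n (m + n) w.
Proof.
apply/funext => t; rewrite !fctE /opL /opI /opI_at.
have -> : t - n - m = t - m - n by ring.
have -> : t - (m + n) = t - m - n by ring.
set v := w _.
(* I_n raises the degree by n, which gives an extra n [shifted_I n v]; it cancels the series at n in
   [lam_shifted_I] and leaves the I_0-term with coefficient [eps n]. *)
have -> : a + (t - m)%:~R = n%:~R + (a + (t - m - n)%:~R) :> C.
  by rewrite !intrD !intrN; ring.
rewrite (linearD (shifted_I n)) (linearZ_LR (shifted_I n)) /= scalerDl.
rewrite [X in X - _]addrAC addrKA.
rewrite -addrA lam_shifted_I -scalerDr /shifted_I intrD.
by rewrite [X in _ *: X]addrC subrKA.
Qed.

(** The twist adds to L_m only operators I_(m+i), all commuting with I_n. *)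
Lemma opLf_opI m n w :
  opLf m (opI n w) - opI n (opLf m w) = n%:~R *: opI_at n (m + n) w.
Proof.
rewrite /opLf (linearD (opI n)) (linear_sum (opI n)) opprD addrACA opL_opI -sumrB.
rewrite big1 ?addr0 // => i _.
by rewrite (linearZ_LR (opI n)) opI_comm subrr.
Qed.

Lemma opL_bracket m n w :
  opL m (opL n w) - opL n (opL m w) = (n - m)%:~R *: opL (m + n) w.
Proof.
apply/funext => t; rewrite !fctE /opL.
have -> : t - n - m = t - m - n by ring.
have -> : t - (m + n) = t - m - n by ring.
set v := w _; set b := a + (t - m - n)%:~R.
have -> : a + (t - m)%:~R = n%:~R + b :> C.
  by rewrite /b !intrD !intrN; ring.
have -> : a + (t - n)%:~R = m%:~R + b :> C.
  by rewrite /b !intrD !intrN; ring.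
rewrite !(linearD (lam_series _)) !(linearZ_LR (lam_series _)) /=.
(* The degree factors exceed b by n and m respectively; these excesses cancel the terms of
   [lam_series_bracket] in n alone and in m alone. *)
rewrite opprD addrACA [X in _ + X](_ : _ = b *: (lam_series m%:~R v - lam_series
  n%:~R v)
  + (lam_series m%:~R (lam_series n%:~R v) - lam_series n%:~R (lam_series m%:~R v))).
  rewrite lam_series_bracket -intrD intrB.
  set A := lam_series n%:~R v; set B := lam_series m%:~R v.
  set K := (n%:~R - m%:~R) *: lam_series _ _.
  have -> : (n%:~R + b) *: (b *: v + A) - (m%:~R + b) *: (b *: v + B) =
      (n%:~R *: (b *: v) - m%:~R *: (b *: v)) + (n%:~R *: A - m%:~R *: B) + b *: (A -
        B).
    rewrite !(scalerDl _ _ b) opprD addrACA -scalerBr [X in X - (_ + B)]addrC addrKA.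
    by rewrite !scalerDr opprD [X in X + _ = _]addrACA.
  rewrite [RHS]scalerDr -scalerBl -!addrA; congr (_ + _).
  rewrite -[A - B]opprB scalerN addKr addrA [- (n%:~R *: A) + _]addrC.
  by rewrite -[m%:~R *: B - _]opprB [LHS]addrC subrK.
by rewrite scalerBr opprD addrACA.
Qed.

HB.instance Definition _ m :=
  GRing.isLinear.Build C (int -> V) (int -> V) *:%R (opLf m) (opLf_linear m).

Lemma opI_atE n l w : (forall k v, eps k *: iot 0%N v = 0) -> opI_at n l w = opI l w.
Proof. by move=> eps0; apply/funext => t; rewrite /opI_at /opI /shifted_I !eps0. Qed.

Lemma opLf_bracket m n w : (forall k v, eps k *: iot 0%N v = 0) ->
  opLf m (opLf n w) - opLf n (opLf m w) = (n - m)%:~R *: opLf (m + n) w.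
Proof.
move=> eps0.
(* The two composites are expanded asymmetrically, so that the difference pairs each I_(n+i) with
   the twisted L_m and each I_(m+i) with the untwisted L_n. The factors n + i and m + i of these
   commutators differ by n - m. *)
have -> : opLf m (opLf n w) = opL m (opL n w)
    + \sum_(i <- fs) fc i *: opI (m + i) (opL n w)
    + \sum_(i <- fs) fc i *: opLf m (opI (n + i) w).
  rewrite [opLf n w]/opLf (linearD (opLf m)) (linear_sum (opLf m)) /=; congr (_ + _).
  by apply: eq_bigr => i _; rewrite (linearZ_LR (opLf m)).
have -> : opLf n (opLf m w) = opL n (opL m w)
    + \sum_(i <- fs) fc i *: opL n (opI (m + i) w)
    + \sum_(i <- fs) fc i *: opI (n + i) (opLf m w).
  rewrite {1}/opLf [in opL n _]/opLf (linearD (opL n)) (linear_sum (opL n)) /=.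
  congr (_ + _ + _).
  by apply: eq_bigr => i _; rewrite (linearZ_LR (opL n)).
rewrite opprD addrACA [- (opL n _ + _)]opprD [X in X + _ = _]addrACA opL_bracket
  -!sumrB.
rewrite -addrA -big_split [opLf (m + n) w]/opLf [RHS]scalerDr scaler_sumr;
  congr (_ + _).
apply: eq_bigr => i _ /=.
rewrite -!scalerBr opLf_opI -[opI (m + i) _ - _]opprB opL_opI !opI_atE //.
have -> : m + (n + i) = m + n + i by ring.
have -> : n + (m + i) = m + n + i by ring.
rewrite -scalerDr addrC -scalerBl -intrB scalerA mulrC -scalerA.
by congr (_%:~R *: _); ring.
Qed.

(** * Subspaces stable under the untwisted operators *)

Section Stable.
Variable U : set (int -> V).
Hypotheses (U0 : U 0) (UP : forall c u w, U u -> U w -> U (c *: u + w)).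
Hypotheses (UI : forall n w, U w -> U (opI n w)).
Hypotheses (UL : forall m w, U w -> U (opL m w)).
Hypothesis class0 :
  (exists2 n, n != 0 & eps n = 0) \/ (forall v, iot 0%N v = 0).

(** For n nonzero with [eps n] = 0, the commutator of L_(l-n) and I_n is n times the full series at
    l, whatever the residue class of l. If I_0 = 0, the full series is already that of I_l. *)
Lemma stable_iot_series l w : U w -> U (fun t => iot_series l%:~R (w (t - l))).
Proof.
move=> Uw; case: class0 => [[n n0 en]|i0]; last first.
  rewrite (_ : (fun _ => _) = opI l w); first exact: UI.
  by apply/funext => t; rewrite /opI /shifted_I i0 scaler0 subr0.
have nC : n%:~R != 0 :> C by rewrite intr_eq0.
rewrite (_ : (fun _ => _) =
    n%:~R^-1 *: (opL (l - n) (opI n w) - opI n (opL (l - n) w))).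
  by apply: (setZ_closed U0 UP); apply: (setB_closed UP); do ?[apply: UL|apply: UI].
rewrite opL_opI scalerA mulVf // scale1r subrK.
by apply/funext => t; rewrite /opI_at en scale0r subr0.
Qed.

Lemma stable_iot_top h l w : (h < N)%N -> (forall j v, (h < j)%N -> iot j v = 0) ->
  U w -> U (fun t => iot h (iot h (w (t - l)))).
Proof.
move=> hN iot_h Uw.
pose x (jk : 'I_N * 'I_N) : int -> V := fun t => iot jk.1 (iot jk.2 (w (t - l))).
pose q (jk : 'I_N * 'I_N) : {poly C} :=
  ((jk.1)`!%:R^-1 * (jk.2)`!%:R^-1) *: ((l%:~R%:P - 'X) ^+ jk.1 * 'X^(jk.2)).
have Uq (m : nat) : U (\sum_jk (q jk).[m%:R] *: x jk).
  have := stable_iot_series (l - m%:Z) (stable_iot_series m%:Z Uw).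
  congr (U _); apply/funext => t.
  rewrite fct_sumE -(pair_big_dep xpredT (fun _ => xpredT)
    (fun j k => (q (j, k)).[m%:R] *: x (j, k) t)) /=.
  rewrite /iot_series; apply: eq_bigr => j _.
  rewrite linear_sum scaler_sumr; apply: eq_bigr => k _.
  rewrite linearZ scalerA /q /x /= hornerZ hornerM !horner_exp hornerD hornerN
    hornerC hornerX.
  have -> : t - (l - m%:Z) - m%:Z = t - l by ring.
  by congr (_ *: _); rewrite /dpow intrB; ring.
(* Terms with j > h or k > h vanish because the operators do; among the others [coef_subXM] leaves
   only j = k = h. *)
have := poly_extract U0 UP Uq (h + h).
pose H := Ordinal hN.
rewrite (bigD1 (H, H)) //= [X in _ + X]big1 ?addr0 => [|[j k] jkH].
  rewrite coefZ coef_subXM // !eqxx mulr1n.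
  move=> /(setZ_closed U0 UP ((h`!%:R^-1 * h`!%:R^-1) * (-1) ^+ h)^-1).
  rewrite scalerA mulVf ?scale1r // !mulf_neq0 ?invr_eq0 ?fact_neq0 //.
  by rewrite expf_neq0 // oppr_eq0 oner_neq0.
have [jh|hj] := leqP j h; last first.
  by apply/funext => t; rewrite /x fctE iot_h // scaler0.
have [kh|hk] := leqP k h; last first.
  by apply/funext => t; rewrite /x fctE [X in iot j X]iot_h // linear0 scaler0.
rewrite coefZ coef_subXM // (_ : _ && _ = false) ?mulr0 ?scale0r //.
by apply: contraNF jkH => /andP[/eqP jh' /eqP kh']; apply/eqP; congr (_, _);
  apply: val_inj.
Qed.

Lemma stable_degree w : U w -> U (fun t => (a + t%:~R) *: w t).
Proof.
move=> Uw; rewrite (_ : (fun _ => _) = opL 0 w); first exact: UL.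
apply/funext => t; rewrite /opL subr0 [lam_series _ _]big1 ?addr0 // => j _.
by rewrite /dpow mulr0z expr0n mul0r scale0r.
Qed.

(** The factor t - z is the action of L_0 - (a + z) in degree t. *)
Lemma stable_kill_support (s : seq int) w :
  U w -> U (fun t => (\prod_(z <- s) (t - z)%:~R) *: w t).
Proof.
move=> Uw; elim: s => [|z s IH] /=.
  by under eq_fun do rewrite big_nil scale1r.
rewrite (_ : (fun _ => _) =
    (fun t => (a + t%:~R) *: ((\prod_(z <- s) (t - z)%:~R) *: w t))
  - (a + z%:~R) *: (fun t => (\prod_(z <- s) (t - z)%:~R) *: w t)).
  by apply: (setB_closed UP); [exact: stable_degree|exact: (setZ_closed U0 UP)].
apply/funext => t; rewrite big_cons !fctE -scalerBl -scalerA intrB.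
by congr (_ *: _); ring.
Qed.

(** The underlying function of [monom v k]. *)
Definition delta_fun v k : int -> V := fun t => if t == k then v else 0.

Lemma delta_fun_sum k (r : nat) (x : 'I_r -> C) (F : nat -> V) :
  delta_fun (\sum_(j < r) x j *: F j) k = \sum_(j < r) x j *: delta_fun (F j) k.
Proof.
apply/funext => t; rewrite /delta_fun fct_sumE; case: ifP => tk.
  by apply: eq_bigr => j _; rewrite fctE tk.
by rewrite big1 // => j _; rewrite fctE tk scaler0.
Qed.

(** Lagrange interpolation: the product over the support points other than k kills all degrees but
    k, where it acts by the nonzero scalar [c]. *)
Lemma stable_delta w k : finite_set [set t | w t != 0] -> U w -> U (delta_fun (w k) k).
Proof.
move=> /finite_seqP[s sE] Uw.
pose s' := [seq z <- s | z != k]; pose c : C := \prod_(z <- s') (k - z)%:~R.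
have c0 : c != 0.
  rewrite prodf_seq_neq0; apply/allP => z; rewrite mem_filter => /andP[zk _] /=.
  by rewrite intr_eq0 subr_eq0 eq_sym.
rewrite (_ : delta_fun (w k) k = c^-1 *: (fun t => (\prod_(z <- s') (t - z)%:~R) *: w
  t)).
  by apply: (setZ_closed U0 UP); exact: stable_kill_support.
apply/funext => t; rewrite /delta_fun fctE; case: eqVneq => [->|tk].
  by rewrite scalerA mulVf // scale1r.
have [->|wt] := eqVneq (w t) 0; first by rewrite !scaler0.
have ts : t \in s'.
  by rewrite mem_filter tk; have : [set` s] t by rewrite -sE.
rewrite (_ : \prod_(z <- s') _ = 0) ?scale0r ?scaler0 //.
by apply/eqP; rewrite prodf_seq_eq0; apply/hasP; exists t => //=; rewrite subrr.
Qed.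

(** The shift by m is applied to v(k - m), so that all results lie in degree k and can be compared
    as m varies; hence the hypothesis in every degree. *)
Lemma stable_delta_iot v : (forall k, U (delta_fun v k)) -> forall j k, U (delta_fun
  (iot j v) k).
Proof.
move=> Uv j k; have [Nj|jN] := leqP N j.
  by rewrite iotN // (_ : delta_fun 0 k = 0) //; apply/funext => t;
    rewrite /delta_fun if_same.
apply: (dpow_extract U0 UP (x := fun j => delta_fun (iot j v) k)) jN => m.
have := stable_iot_series m%:Z (Uv (k - m%:Z)).
rewrite -(delta_fun_sum k (fun j : 'I_N => dpow m%:R j) (fun j => iot j v));
  congr (U _); apply/funext => t; rewrite /delta_fun.
by rewrite (inj_eq (addIr _)); case: ifP => // _; rewrite linear0.
Qed.

Lemma stable_delta_lam v : (forall k, U (delta_fun v k)) -> forall j k, U (delta_fun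
  (lam j v) k).
Proof.
move=> Uv j k; have [Nj|jN] := leqP N j.
  by rewrite lamN // (_ : delta_fun 0 k = 0) //; apply/funext => t;
    rewrite /delta_fun if_same.
(* The coefficients of L_m v(k - m) in the divided powers of m: the degree factor a + k - m
   contributes (a + k) v at index 0 and -v at index 1. The latter is added back at the end when j =
   0. *)
pose x i : V := if i is i'.+1 then lam i' v - (i' == 0%N)%:R *: v else (a + k%:~R) *: v.
have : U (delta_fun (x j.+1) k).
  apply: (dpow_extract U0 UP (n := N.+1) (x := fun j => delta_fun (x j) k)) => // m.
  have := UL m%:Z (Uv (k - m%:Z)).
  rewrite -(delta_fun_sum k (fun j : 'I_N.+1 => dpow m%:R j) x); congr (U _);
    apply/funext => t; rewrite /delta_fun /opL.
  rewrite (inj_eq (addIr _)); case: ifP => [/eqP ->|_]; last by rewrite !linear0 addr0.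
  rewrite big_ord_recl dpow0 scale1r /=.
  rewrite (eq_bigr (fun i : 'I_N => dpow m%:R i.+1 *: lam i v
    - dpow m%:R i.+1 *: ((i == 0 :> nat)%:R *: v))); last by move=> i _;
      rewrite -scalerBr.
  rewrite sumrB.
  have <- : m%:R *: v = \sum_(i < N) dpow m%:R i.+1 *: ((i == 0 :> nat)%:R *: v).
    pose o := Ordinal (leq_ltn_trans (leq0n j) jN).
    rewrite (bigD1 o) //= big1 ?addr0 => [|i io].
      by rewrite scale1r /dpow expr1 factS fact0 divr1.
    rewrite (_ : (i == 0 :> nat) = false) ?scale0r ?scaler0 //.
    by apply: contraNF io => /eqP i0; apply/eqP/val_inj.
  by rewrite intrB addrA scalerBl [LHS]addrAC -addrA.
rewrite /x => /(setD_closed UP (setZ_closed U0 UP (j == 0%N)%:R (Uv k))).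
congr (U _); apply/funext => t; rewrite /delta_fun !fctE.
by case: ifP => _; [rewrite addrC subrK|rewrite scaler0 addr0].
Qed.

Hypothesis simple : forall V0 : set V,
  V0 0 -> (forall c u v, V0 u -> V0 v -> V0 (c *: u + v)) ->
  (forall j v, V0 v -> V0 (lam j v)) -> (forall j v, V0 v -> V0 (iot j v)) ->
  (exists2 v, V0 v & v != 0) -> forall v, V0 v.

(** The kernel of I_h is stable under L_j because the commutator h I_(h+j) vanishes on it: for j > 0
    by the level, for j = 0 by membership in the kernel. *)
Lemma iot_top_inj h : (forall j v, (h < j)%N -> iot j v = 0) ->
  (exists v, iot h v <> 0) -> forall v, v != 0 -> iot h v != 0.
Proof.
move=> iot_h [u iu] v v0; apply/eqP => iv; apply: iu.
apply: (simple (V0 := [set x | iot h x = 0])) => /=; last by exists v.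
- exact: linear0.
- by move=> c x y ix iy; rewrite linearP ix iy scaler0 addr0.
- move=> j x ix; apply/eqP;
  rewrite -oppr_eq0 -[- _]add0r -[X in X - _](linear0 (lam j)).
  rewrite -ix lam_iot; case: j => [|j]; first by rewrite add0n ix scaler0.
  by rewrite iot_h ?scaler0 ?ix // addSn ltnS leq_addl.
- by move=> j x ix; rewrite iot_iot ix linear0.
Qed.

Lemma stable_full h w : (h < N)%N -> (forall j v, (h < j)%N -> iot j v = 0) ->
  (exists v, iot h v <> 0) ->
  finite_set [set t | w t != 0] -> U w -> w <> 0 -> forall v k, U (delta_fun v k).
Proof.
move=> hN iot_h iot_nz wfin Uw w0.
have [k0 wk0] : exists k0, w k0 != 0.
  apply: contrapT => /forallNP wk; apply: w0; apply/funext => k.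
  by have /negP := wk k; rewrite negbK => /eqP.
have Uk := stable_delta k0 wfin Uw; set v := w k0 in wk0 Uk.
(* The shift in [stable_iot_top] is arbitrary, so the single degree k0 gives all degrees k, with v
   replaced by the nonzero vector I_h^2 v. *)
have UE k : U (delta_fun (iot h (iot h v)) k).
  have := stable_iot_top (k - k0) hN iot_h Uk.
  congr (U _); apply/funext => t; rewrite /delta_fun.
  have -> : (t - (k - k0) == k0) = (t == k) by rewrite subr_eq addrC subrK.
  by case: ifP => // _; rewrite !linear0.
suff : forall v, (fun v => forall k, U (delta_fun v k)) v by [].
apply: simple => [k|c x y Ux Uy k|j x Ux k|j x Ux k|].
- by rewrite (_ : delta_fun 0 k = 0) //; apply/funext => t; rewrite /delta_fun if_same.
- rewrite (_ : delta_fun _ k = c *: delta_fun x k + delta_fun y k); first exact: UP.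
  apply/funext => t; rewrite /delta_fun !fctE.
  by case: ifP => _ //; rewrite scaler0 addr0.
- exact: stable_delta_lam.
- exact: stable_delta_iot.
- by exists (iot h (iot h v)) => //; do 2!apply: (iot_top_inj iot_h iot_nz).
Qed.

End Stable.
End LevelModule.

(** * Coefficients of Laurent polynomials and finitely supported sums *)

Section LaurentCoefficients.
Variables (C : numFieldType) (V : lmodType C).
Implicit Types (w : laurent V) (F : int -> laurent V).

Lemma lcoef_sum (J : Type) (r : seq J) (F : J -> laurent V) :
  lcoef (\sum_(i <- r) F i) = \sum_(i <- r) lcoef (F i).
Proof. exact: (raddf_sum val). Qed.

Lemma lcoef_supp w : finite_set [set k | w k != 0].
Proof. by have /asboolP := lcoef_finite w. Qed.

Definition supp w : seq int := fset_set [set k | w k != 0].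

Lemma supp_notin w k : k \notin fset_set [set k | w k != 0] -> w k = 0.
Proof.
by rewrite in_fset_set ?notin_setE; [move=> /negP;
  rewrite negbK => /eqP|exact: lcoef_supp].
Qed.

(** A sum over a set defaults to 0 when infinitely many terms are nonzero; the hypothesis confines
    the nonzero terms to the finite support of w. *)
Lemma fsum_supp (Z : nmodType) w (F : int -> Z) : (forall k, w k = 0 -> F k = 0) ->
  \sum_(k \in [set: int]) F k = \sum_(k <- supp w) F k.
Proof. by move=> F0; apply: fsbigTE => k /supp_notin; exact: F0. Qed.

Lemma monom0 k : monom (0 : V) k = 0.
Proof. by apply/val_inj/funext => t /=; rewrite if_same. Qed.

Lemma lcoef_fsum_monom w (G : int -> V) m : (forall k, w k = 0 -> G k = 0) ->
  lcoef (\sum_(k \in [set: int]) monom (G k) (m + k)) = fun t => G (t - m).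
Proof.
move=> G0; rewrite (fsum_supp (w := w)); last by move=> k /G0 ->; exact: monom0.
rewrite lcoef_sum fct_sumE; apply/funext => t /=.
have [tw|tw] := boolP (t - m \in supp w).
  rewrite (bigD1_seq (t - m)) ?fset_uniq //= subrKC eqxx big1 ?addr0 // => k kt.
  by case: eqP => // tk; rewrite tk addrAC subrr add0r eqxx in kt.
rewrite G0; last exact: supp_notin.
rewrite big_seq big1 // => k kw; case: eqP => // tk.
by move: tw; rewrite tk addrAC subrr add0r kw.
Qed.

Lemma laurent_monom_sum w : w = \sum_(k <- supp w) monom (w k) k.
Proof.
rewrite -(fsum_supp (w := w)) => [|k ->]; last exact: monom0.
apply/val_inj/funext => t /=.
rewrite (eq_fsbigr (fun k => monom (w k) (0 + k))) => [|k _]; last by rewrite add0r.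
by rewrite (@lcoef_fsum_monom w w) // subr0.
Qed.

Lemma fsum_nat (n : nat) (F : nat -> V) : (forall j, (n <= j)%N -> F j = 0) ->
  \sum_(j \in [set: nat]) F j = \sum_(j < n) F j.
Proof.
move=> F0; rewrite fsbig_ord; apply/esym/fsbig_widen => //= j [_ /negP].
by rewrite -leqNgt => /F0.
Qed.

End LaurentCoefficients.

(** * The minimum of d and its residue classes *)

Section MinD.
Variables (p : nat) (p_gt0 : (0 < p)%N) (d : p.-tuple 'I_2).

Lemma min_d_le1 : (min_d d <= 1)%N.
Proof.
by rewrite /min_d; elim/big_ind: _ => // [x y x1 y1|i _]; [rewrite geq_min x1|case: i].
Qed.

Lemma min_d_le i : (min_d d <= tnth d i)%N.
Proof.
rewrite /min_d; have := mem_tnth i d; rewrite memtE.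
move: (tnth d i) => x; elim: (tval d) => // y s IH.
by rewrite inE big_cons geq_min => /predU1P[-> | /IH ->]; rewrite ?leqnn ?orbT.
Qed.

Lemma min_d0 : min_d d = 0%N -> exists i, tnth d i = 0 :> nat.
Proof.
rewrite /min_d => d0; apply: contrapT => /forallNP d_neq0.
suff : (0 < \big[minn/1%N]_(x <- d) (x : nat))%N by rewrite d0.
rewrite big_seq; elim/big_ind: _ => // [x y x0 y0|x /tnthP[i ->]].
  by rewrite leq_min x0.
by rewrite lt0n; apply/eqP; exact: d_neq0.
Qed.

Lemma d_resE n : exists i : 'I_p, d_res d n = tnth d i.
Proof.
have np : (`|(n %% p%:Z)%Z|%N < p)%N by have := @ltz_pmod n p%:Z; lia.
by exists (Ordinal np); rewrite /d_res (tnth_nth ord0).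
Qed.

(** The representative i + p of the class of i is positive, hence nonzero even for i = 0; later
    arguments divide by it. *)
Lemma d_res_ord (i : 'I_p) : d_res d (i%:Z + p%:Z) = tnth d i.
Proof. by rewrite /d_res modzDr modz_small ?ltz_nat ?ltn_ord //= (tnth_nth ord0). Qed.

End MinD.

(** * Identification of [MTf] with the abstract operators *)

Section LoopModule.
Variables (C : numFieldType) (p : nat) (p_gt0 : (0 < p)%N) (d : p.-tuple 'I_2).
Variables (a : C) (V : lmodType C) (act : T_basis -> V -> V).
Hypothesis act_module : is_module (T_sub (min_d d)) act.
Variables (h q : nat).
Hypothesis act_level : annihilating_level (min_d d) act h q.
Variable f : laurent C^o.

(** One truncation bound above both levels. *)
Let N := (h + q).+1.

Lemma act_L_linear j : linear (act (L (j : nat)%:Z)).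
Proof. by case: act_module => lin _; exact: lin. Qed.

(* In the case of T_1, whose modules carry no I_0, letting I_0 act by 0 turns
   them into modules over T_0; this treats both algebras at once. *)
Definition act_I (j : nat) v : V := if (min_d d <= j)%N then act (I j%:Z) v else 0.

Lemma act_I_linear j : linear (act_I j).
Proof.
move=> c u v; rewrite /act_I; case: ifP => dj; last by rewrite scaler0 addr0.
by case: act_module => lin _; exact: lin.
Qed.

Let lam (j : nat) : {linear V -> V} :=
  HB.pack (act (L j%:Z)) (GRing.isLinear.Build C V V *:%R _ (act_L_linear j)).
Let iot (j : nat) : {linear V -> V} :=
  HB.pack (act_I j) (GRing.isLinear.Build C V V *:%R _ (act_I_linear j)).

Lemma act_L_vanish j v : (N <= j)%N -> lam j v = 0.
Proof. by move=> Nj; case: act_level => _ _ _ _ L0; apply: L0; rewrite /N in Nj;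
  lia. Qed.

Lemma act_I_top j v : (h < j)%N -> iot j v = 0.
Proof.
by move=> hj; case: act_level => _ _ _ I0 _; rewrite /= /act_I I0 // if_same.
Qed.

Lemma act_I_vanish j v : (N <= j)%N -> iot j v = 0.
Proof. by move=> Nj; apply: act_I_top; rewrite /N in Nj; lia. Qed.

(** The value [act C_L] is unconstrained, but its coefficient vanishes: j + k = 0 forces j = k = 0,
    where j^3 - j = 0. *)
Lemma act_LL j k v :
  lam j (lam k v) - lam k (lam j v) = (k%:R - j%:R) *: lam (j + k)%N v.
Proof.
case: act_module => _ rel; rewrite [LHS]rel //= !big_cons big_nil /= addr0.
rewrite intrB -PoszD; case: eqP => [|_]; last by rewrite mulr0n scale0r addr0.
case: j k => [|j] [|k] // _.
rewrite (_ : _ *+ _ = 0) ?scale0r ?addr0 //.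
by rewrite (_ : _ ^+ 3 = 0) // mul0r mul0rn.
Qed.

Lemma act_LI j k v :
  lam j (iot k v) - iot k (lam j v) = k%:R *: iot (j + k)%N v.
Proof.
rewrite /= /act_I; case: (leqP (min_d d) k) => dk; last first.
  (* An index below the minimum of d can only be 0, and then the structure constant k vanishes. *)
  have -> : k = 0%N by have := min_d_le1 d; lia.
  by rewrite scale0r subr0; exact: (linear0 (lam j)).
case: act_module => _ rel; rewrite [LHS]rel //= ?lez_nat // !big_cons big_nil /= addr0.
rewrite -PoszD (leq_trans dk (leq_addl _ _)).
case: eqP => [|_]; last by rewrite mulr0n scale0r addr0.
case: j => [|j] // _.
by rewrite (_ : _ *+ _ = 0) ?scale0r ?addr0.
Qed.

Lemma act_II j k v : iot j (iot k v) = iot k (iot j v).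
Proof.
rewrite /= /act_I; case: (leqP (min_d d) j) => dj; case: (leqP (min_d d) k) => dk //.
- case: act_module => _ rel; apply: subr0_eq; rewrite rel //= ?lez_nat //.
  rewrite big_cons big_nil /= addr0 -PoszD; case: eqP => [|_];
    last by rewrite mulr0n scale0r.
  by case: j dj => [|j] // _ _; rewrite mul0rn scale0r.
- by have := linear0 (iot j); rewrite /= /act_I dj.
- by have := linear0 (iot k); rewrite /= /act_I dk.
Qed.

Let eps (n : int) : C := (d_res d n)%:R.

Lemma act_L_series n v :
  \sum_(j \in [set: nat]) (n%:~R ^+ j.+1 / (j.+1)`!%:R) *: act (L j%:Z) v =
  lam_series N lam n%:~R v.
Proof. by apply: fsum_nat => j Nj; have /= -> := act_L_vanish v Nj;
  rewrite scaler0. Qed.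

Lemma act_I_series n v :
  \sum_(j \in [set: nat]) (n%:~R ^+ (j + d_res d n) / (j + d_res d n)`!%:R)
    *: act (I (j + d_res d n)%N%:Z) v = shifted_I N iot eps n v.
Proof.
have [i di] := d_resE p_gt0 d n; have dn : (min_d d <= d_res d n)%N.
  by rewrite di min_d_le.
have actE j : act (I (j + d_res d n)%N%:Z) v = iot (j + d_res d n)%N v.
  by rewrite /= /act_I (leq_trans dn (leq_addl _ _)).
rewrite (fsum_nat (n := N)) => [|j Nj]; last first.
  by rewrite actE act_I_vanish ?scaler0 // (leq_trans Nj) ?leq_addr.
under eq_bigr do rewrite actE.
rewrite /shifted_I /eps /iot_series.
have : (d_res d n <= 1)%N by rewrite di; case: (tnth d i) => -[|[]].
case: (d_res d n) => [|[]] // _.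
  by rewrite scale0r subr0; apply: eq_bigr => j _; rewrite addn0.
(* With d_n = 1 the left sum runs over the indices 1, ..., N and the right one over 1, ..., N - 1;
   the additional term is zero since I_N = 0. *)
rewrite scale1r [in RHS]big_ord_recl dpow0 scale1r [RHS]addrC addKr big_ord_recr /=.
rewrite addn1; have /= -> := act_I_vanish v (leqnn N); rewrite scaler0 addr0.
by apply: eq_bigr => j _; rewrite addn1.
Qed.

Lemma lcoef_MT_L m w : lcoef (MT d a act (L m) w) = opL N lam a m w.
Proof.
rewrite /MT (@lcoef_fsum_monom _ _ w) => [|k wk].
  by apply/funext => t; rewrite act_L_series.
by rewrite act_L_series wk !linear0 addr0.
Qed.

Lemma lcoef_MT_I n w : lcoef (MT d a act (I n) w) = opI N iot eps n w.
Proof.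
rewrite /MT (@lcoef_fsum_monom _ _ w) => [|k wk].
  by apply/funext => t; rewrite act_I_series.
by rewrite act_I_series wk linear0.
Qed.

Lemma lcoef_MTf_L m w :
  lcoef (MTf d a act f (L m) w) = opLf N lam iot a eps (supp f) f m w.
Proof.
rewrite /MTf (fsum_supp (w := f)) => [|k ->]; last by rewrite scale0r.
rewrite /opLf -lcoef_MT_L -[lcoef (_ + _)]/(lcoef _ + lcoef _).
by congr (_ + _); rewrite lcoef_sum; apply: eq_bigr => i _; rewrite -lcoef_MT_I.
Qed.

Lemma MTf_irreducible :
  irreducible (T_sub (min_d d)) act -> irreducible setT (MTf d a act f).
Proof.
case=> [[v0 v00] act_simple]; split.
  by exists (monom v0 0) => /(congr1 (fun w => lcoef w 0)).
move=> U [U0 UP US].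
have [[w Uw w0]|U_0] := pselect (exists2 w, U w & w <> 0); last first.
  left; apply/seteqP; split => [w Uw /=|w -> //].
  by apply: contrapT => w0; apply: U_0; exists w.
right; pose U' : set (int -> V) := [set lcoef u | u in U].
have U'0 : U' 0 by exists 0.
have U'P c x y : U' x -> U' y -> U' (c *: x + y).
  by move=> [u Uu <-] [z Uz <-]; exists (c *: u + z) => //; exact: UP.
have U'I n x : U' x -> U' (opI N iot eps n x).
  by move=> [u Uu <-]; exists (MTf d a act f (I n) u); [exact: US|exact: lcoef_MT_I].
have U'L m x : U' x -> U' (opL N lam a m x).
  move=> [u Uu <-].
  (* Untwisting: the I_(m+i) preserve the subspace, so they can be subtracted from the twisted
     L_m. *)
  have -> : opL N lam a m u = opLf N lam iot a eps (supp f) f m u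
      - \sum_(i <- supp f) (f i : C) *: opI N iot eps (m + i) u by rewrite addrK.
  apply: (setB_closed U'P).
    by exists (MTf d a act f (L m) u); [exact: US|exact: lcoef_MTf_L].
  apply: (set_sum_closed U'0 U'P) => i _; apply: (setZ_closed U'0 U'P).
  by apply: U'I; exists u.
have class0 : (exists2 n, n != 0 & eps n = 0) \/ (forall v, iot 0%N v = 0).
  have [d0|d0] := eqVneq (min_d d) 0%N; last first.
    by right => v; rewrite /= /act_I leqn0 (negbTE d0).
  left; have [i di] := min_d0 d0.
  by exists (i%:Z + p%:Z); [lia|rewrite /eps d_res_ord di].
have simple (V0 : set V) : V0 0 ->
    (forall c u v, V0 u -> V0 v -> V0 (c *: u + v)) ->
    (forall j v, V0 v -> V0 (lam j v)) -> (forall j v, V0 v -> V0 (iot j v)) ->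
    (exists2 v, V0 v & v != 0) -> forall v, V0 v.
  move=> V00 V0P V0L V0I [v V0v v_neq0].
  have [|V0E|-> //] := act_simple V0; last by move: V0v v_neq0; rewrite V0E /= => ->;
    rewrite eqxx.
  split=> // -[[k|k]|[k|k]| | |] //=.
    by move=> _; exact: V0L.
  by rewrite lez_nat => dk x /(V0I k); rewrite /= /act_I dk.
have Udelta : forall v k, U' (delta_fun v k).
  have [dh Ih _ _ _] := act_level.
  apply: (stable_full act_L_vanish act_I_vanish act_LI act_II U'0 U'P U'I U'L class0
    simple
    (h := h) (w := w)) => //.
  - by rewrite /N; lia.
  - by move=> j v; exact: act_I_top.
  - by have [v Iv] := Ih; exists v; rewrite /= /act_I dh.
  - exact: lcoef_supp.
  - by exists w.
  - by move=> w0'; apply: w0; exact/val_inj.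
apply/seteqP; split=> // u _; rewrite (laurent_monom_sum u).
apply: (set_sum_closed U0 UP) => k _.
by have [x Ux /= xE] := Udelta (u k) k; rewrite (_ : monom _ _ = x) //; exact/val_inj.
Qed.

Lemma MTf_linear x : linear (MTf d a act f x).
Proof.
move=> c u w; case: x => [m|m| | |]; try by rewrite /= scaler0 addr0.
- apply/val_inj; rewrite -[LHS]/(lcoef _) -[RHS]/(c *: lcoef _ + lcoef _).
  by rewrite !lcoef_MTf_L [LHS]opLf_linear.
- apply/val_inj; rewrite -[LHS]/(lcoef _) -[RHS]/(c *: lcoef _ + lcoef _) /MTf.
  by rewrite !lcoef_MT_I [LHS]opI_linear.
Qed.

(** Under this hypothesis the I_0-correction is zero in every residue class, so [opI_at] agrees with
    [opI] and the commutators become the relations of T with central elements acting as 0. *)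
Lemma MTf_module : (forall k v, (d_res d k)%:R *: act_I 0 v = 0) ->
  is_module setT (MTf d a act f).
Proof.
move=> eps0; split=> [x _|x y _ _ w]; first exact: MTf_linear.
have MTf0 z : MTf d a act f z 0 = 0.
  have := MTf_linear z (-1) 0 0; rewrite scaleN1r addr0 oppr0 => ->.
  by rewrite scaleN1r addNr.
have LL m n : MTf d a act f (L m) (MTf d a act f (L n) w)
    - MTf d a act f (L n) (MTf d a act f (L m) w) =
    (n - m)%:~R *: MTf d a act f (L (m + n)) w.
  apply/val_inj; rewrite -[LHS]/(lcoef _ - lcoef _) -[RHS]/(_ *: lcoef _) !lcoef_MTf_L.
  by rewrite (opLf_bracket act_L_vanish act_I_vanish act_LL act_LI act_II).
have LI m n : MTf d a act f (L m) (MTf d a act f (I n) w)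
    - MTf d a act f (I n) (MTf d a act f (L m) w) =
    n%:~R *: MTf d a act f (I (m + n)) w.
  apply/val_inj; rewrite -[LHS]/(lcoef _ - lcoef _) -[RHS]/(_ *: lcoef _).
  rewrite !lcoef_MTf_L !lcoef_MT_I !lcoef_MTf_L.
  by rewrite (opLf_opI act_I_vanish act_LI act_II) opI_atE.
have II m n : MTf d a act f (I m) (MTf d a act f (I n) w)
    - MTf d a act f (I n) (MTf d a act f (I m) w) = 0.
  apply/val_inj; rewrite -[LHS]/(lcoef _ - lcoef _) !lcoef_MT_I.
  by rewrite (opI_comm _ act_II) subrr.
case: x y => [m|m| | |] [n|n| | |]; rewrite ?big_cons ?big_nil ?MTf0 ?subrr;
  try by rewrite /= ?scaler0 ?addr0 ?MTf0 ?subrr.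
- by rewrite LL [X in _ = _ + X](_ : _ = 0) ?addr0 //= scaler0.
- by rewrite LI [X in _ = _ + X](_ : _ = 0) ?addr0 //= scaler0.
- rewrite [X in _ = _ + X](_ : _ = 0) ?addr0 //= ?scaler0 //.
  by rewrite -opprB LI scaleNr.
- by rewrite II /= scaler0 addr0.
Qed.

Lemma MTf_module_inv : is_module setT (MTf d a act f) ->
  forall i j : 'I_p, tnth d i != tnth d j -> forall v, act (I 0) v = 0.
Proof.
move=> [_ rel] i j dij v.
(* Two distinct entries in {0,1} force the minimum 0, so [act_I 0] is the given action of I_0. *)
have d0 : min_d d = 0%N.
  have := min_d_le d i; have := min_d_le d j; have := min_d_le1 d.
  move: dij; rewrite -val_eqE /=; case: (tnth d i) (tnth d j) => [x x2] [y y2] /=; lia.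
(* With n in the class of i and m + n in that of j, the relation for [L_m, I_n] on v(0) compares
   corrections d_i I_0 v and d_j I_0 v; n is nonzero and cancels. *)
pose n := i%:Z + p%:Z; pose m := j%:Z - i%:Z.
have n0 : n%:~R != 0 :> C by rewrite intr_eq0 /n; lia.
have mn : m + n = j%:Z + p%:Z by rewrite /m /n; lia.
have : MTf d a act f (L m) (MTf d a act f (I n) (monom v 0))
    - MTf d a act f (I n) (MTf d a act f (L m) (monom v 0)) =
    n%:~R *: MTf d a act f (I (m + n)) (monom v 0).
  by rewrite rel // !big_cons big_nil [X in _ + X = _](_ : _ = 0) ?addr0 //= scaler0.
move=> /(congr1 (fun w => lcoef w (m + n))).
rewrite -[LHS]/((lcoef _ - lcoef _) _) -[RHS]/((_ *: lcoef _) _).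
rewrite !lcoef_MTf_L !lcoef_MT_I !lcoef_MTf_L (opLf_opI act_I_vanish act_LI act_II).
rewrite !fctE => /(scalerI n0); rewrite /opI_at /opI /shifted_I subrr /=.
move=> /addrI/oppr_inj/eqP; rewrite -subr_eq0 -scalerBl scaler_eq0 subr_eq0.
rewrite /eps mn !d_res_ord eqr_nat val_eqE (negbTE dij) /= /act_I d0.
by move/eqP.
Qed.

End LoopModule.

(** Since [irreducible] speaks only of stable subspaces, the equivalence states separately when the
    operators satisfy the relations of T. *)
Theorem theorem6p1 (R : realType) (p : nat) (hp : (1 < p)%N)
    (d : p.-tuple 'I_2) (a : R[i]) (V : lmodType R[i])
    (act : T_basis -> V -> V)
    (hV : is_module (T_sub (min_d d)) act)
    (hirr : irreducible (T_sub (min_d d)) act)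
    (hlevel : exists h q : nat, annihilating_level (min_d d) act h q)
    (f : laurent R[i]^o) :
  irreducible setT (MTf d a act f) /\
  (is_module setT (MTf d a act f) <->
   (forall i j : 'I_p, tnth d i = tnth d j) \/
   (forall v : V, act (I 0) v = 0)).
Proof.
have p_gt0 : (0 < p)%N := ltnW hp.
have [h [q level]] := hlevel; split.
  exact: (MTf_irreducible p_gt0 a hV level).
split=> [mod|d_or_I0].
  have [dC|/existsNP[i /existsNP[j dij]]] := pselect (forall i j, tnth d i = tnth d j).
    by left.
  by right; apply: (MTf_module_inv p_gt0 hV level mod (i := i) (j := j)); apply/eqP.
(* If the minimum of d is 1, [act_I 0] is zero by construction; if it is 0 and d is constant, all
   d_k are 0. *)
apply: (MTf_module p_gt0 a hV level) => k v; rewrite /act_I leqn0.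
case: eqVneq => [d0|_]; last by rewrite scaler0.
case: d_or_I0 => [dC|->]; last by rewrite scaler0.
have [i di] := min_d0 d0; have [j ->] := d_resE p_gt0 d k.
by rewrite (dC j i) di scale0r.
Qed.
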